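(* Let $G$ be a finite simple graph that is prime and contains no induced subgraph isomorphic to $P_5$, $\overline{P_5}$, or $C_5$. Then either $G$ is a split graph, or $G$ admits a split divide, or $\overline{G}$ admits a split divide.
   Context: $P_n$ is the path on $n$ vertices, $C_n$ the cycle on $n$ vertices, $\overline{G}$ the complement of $G$. A graph is split if its vertex set can be partitioned into a clique and a stable set. For $S\subseteq V(G)$ and $v\notin S$: $v$ is complete to $S$ if adjacent to all of $S$, anticomplete if adjacent to none, mixed on $S$ otherwise; a set is complete (anticomplete) to a disjoint set if each of its vertices is. An anticomponent of $S$ is a subset of $S$ inducing a connected component of $\overline{G}[S]$. A homogeneous set is a non-empty $S\subseteq V(G)$ such that every vertex of $V(G)\setminus S$ is complete or anticomplete to $S$; it is proper if $|S|\ge2$ and $S\neq V(G)$; $G$ is prime if it has no proper homogeneous set. A split divide of $G$ is a partition $(A,B,C,L,T)$ of $V(G)$ (where $B$ and $T$ may be empty) such that: $|A|\ge 2$, $A$ is complete to $B$ and anticomplete to $C\cup T$, and some vertex of $A$ is complete to $L$; $L$ is a non-empty clique, every vertex of $L$ is mixed on $A$, and $L$ is complete to $B\cup C$; $|C|\ge 2$, some vertex of $C$ is complete to $B$, and no vertex of $C$ is mixed on any anticomponent of $B$; $T$ is a (possibly empty) stable set and is anticomplete to $C$. *)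

(* Defs.v *)
From HB Require Import structures.
From mathcomp Require Import all_boot.

Set Implicit Arguments.
Unset Strict Implicit.
Unset Printing Implicit Defensive.

Record sgraph := SGraph {
  vertex :> finType;
  adj : rel vertex;
  adj_sym : symmetric adj;
  adj_irr : irreflexive adj
}.

Section Complement.
Variable G : sgraph.

Definition compl_adj : rel G := fun x y => (x != y) && ~~ adj x y.

Lemma compl_adj_sym : symmetric compl_adj.
Proof. by move=> x y; rewrite /compl_adj eq_sym adj_sym. Qed.

Lemma compl_adj_irr : irreflexive compl_adj.
Proof. by move=> x; rewrite /compl_adj eqxx. Qed.

Definition compl_graph : sgraph := SGraph compl_adj_sym compl_adj_irr.

End Complement.

Section PathsAndCycles.
Variable n : nat.

Definition path_adj : rel 'I_n := fun i j => (i.+1 == j) || (j.+1 == i).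

Lemma path_adj_sym : symmetric path_adj.
Proof. by move=> i j; rewrite /path_adj orbC. Qed.

Lemma path_adj_irr : irreflexive path_adj.
Proof. by move=> i; rewrite /path_adj orbb; apply/negbTE; rewrite neq_ltn ltnSn orbT. Qed.

Definition path_graph : sgraph := SGraph path_adj_sym path_adj_irr.

(* This is the n-cycle for 3 <= n; [i != j] only matters when n = 1. *)
Definition cycle_adj : rel 'I_n := fun i j =>
  (i != j) && ((i.+1 == j %[mod n]) || (j.+1 == i %[mod n])).

Lemma cycle_adj_sym : symmetric cycle_adj.
Proof. by move=> i j; rewrite /cycle_adj eq_sym orbC. Qed.

Lemma cycle_adj_irr : irreflexive cycle_adj.
Proof. by move=> i; rewrite /cycle_adj eqxx. Qed.

Definition cycle_graph : sgraph := SGraph cycle_adj_sym cycle_adj_irr.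

End PathsAndCycles.

Definition contains_induced (H G : sgraph) : Prop :=
  exists f : H -> G, injective f /\ forall x y, adj (f x) (f y) = adj x y.

Section Notions.
Variable G : sgraph.
Implicit Types (v : G) (S K : {set G}).

Definition clique S : bool :=
  [forall x in S, forall y in S, (x != y) ==> adj x y].

Definition stable_set S : bool :=
  [forall x in S, forall y in S, ~~ adj x y].

Definition split_graph : Prop :=
  exists K S, [/\ K :|: S = [set: G], [disjoint K & S], clique K & stable_set S].

(* The next three notions are only used for v \notin S. *)
Definition complete_to v S : bool := [forall x in S, adj v x].
Definition anticomplete_to v S : bool := [forall x in S, ~~ adj v x].
Definition mixed_on v S : bool := ~~ complete_to v S && ~~ anticomplete_to v S.

(* The next two notions are only used for disjoint S and K. *)
Definition set_complete_to S K : bool := [forall v in S, complete_to v K].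
Definition set_anticomplete_to S K : bool := [forall v in S, anticomplete_to v K].

(* K is the vertex set of a connected component of the subgraph induced on S. *)
Definition component S K : Prop :=
  exists2 x, x \in S & K = [set y | connect [rel u v in S | adj u v] x y].

Definition homogeneous S : Prop :=
  S != set0 /\ forall v, v \notin S -> complete_to v S \/ anticomplete_to v S.

Definition proper_homogeneous S : Prop :=
  [/\ homogeneous S, 2 <= #|S| & S != [set: G]].

Definition prime_graph : Prop := ~ exists S, proper_homogeneous S.

End Notions.

Definition anticomponent (G : sgraph) (S K : {set G}) : Prop :=
  @component (compl_graph G) S K.

Record split_divide (G : sgraph) (A B C L T : {set G}) : Prop := SplitDivide {
  sd_cover : A :|: B :|: C :|: L :|: T = [set: G];
  sd_disjoint : pairwise (fun X Y : {set G} => [disjoint X & Y]) [:: A; B; C; L; T];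

  sd_cardA : 2 <= #|A|;
  sd_A_B : set_complete_to A B;
  sd_A_CT : set_anticomplete_to A (C :|: T);
  sd_A_L : exists2 a, a \in A & complete_to a L;

  sd_L_neq0 : L != set0;
  sd_L_clique : clique L;
  sd_L_A : forall l, l \in L -> mixed_on l A;
  sd_L_BC : set_complete_to L (B :|: C);

  sd_cardC : 2 <= #|C|;
  sd_C_B : exists2 c, c \in C & complete_to c B;
  sd_C_anticomp : forall c K, c \in C -> anticomponent B K -> ~~ mixed_on c K;

  sd_T_stable : stable_set T;
  sd_T_C : set_anticomplete_to T C
}.

Definition admits_split_divide (G : sgraph) : Prop :=
  exists A B C L T : {set G}, split_divide A B C L T.

(* Main.v *)
Require Import Defs.
From mathcomp Require Import all_boot.
From Stdlib Require Import FunctionalExtensionality.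

Set Implicit Arguments.
Unset Strict Implicit.
Unset Printing Implicit Defensive.

(** A graph without induced [2K2], [C4] and [C5] is split, so up to complement
    there are two disjoint, mutually anticomplete edges.  Take a maximal connected
    set [X] whose non-neighbours still span an edge; let [B] and [L] be the
    vertices complete to, respectively mixed on [X], and let [C] and [T] be the
    non-isolated, respectively isolated, vertices among the non-neighbours of [X].
    Then [(X, B, C, L, T)] is a split divide as soon as [L] is a clique.

    Otherwise some anticomponent [D] of [B :|: L] has at least two vertices and is
    complete to [C].  Every vertex outside [D :|: T] is complete or anticomplete to
    [D], so by primality some vertices of [T] are mixed on [D], and they form a
    clique in the complement because [T] is stable.  When [D] is chosen so that as
    few vertices of [T] as possible fail to be complete to it, the same
    construction carried out around [D] in the complement is a split divide. *)

(** * The forbidden five-vertex graphs *)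

Definition five_free (G : sgraph) : Prop :=
  [/\ ~ contains_induced (path_graph 5) G,
      ~ contains_induced (compl_graph (path_graph 5)) G
    & ~ contains_induced (cycle_graph 5) G].

Definition twin_free (H : sgraph) : Prop :=
  forall i j : H, (forall k, adj i k = adj j k) -> i = j.

Ltac twin_free_5 :=
  move=> [[|[|[|[|[|?]]]]] ?] // [[|[|[|[|[|?]]]]] ?] //;
  let E := fresh in intro E; apply: val_inj => //=;
  move: (E (@Ordinal 5 0 isT)) (E (@Ordinal 5 1 isT)) (E (@Ordinal 5 2 isT))
        (E (@Ordinal 5 3 isT)) (E (@Ordinal 5 4 isT)).

Lemma path5_twin_free : twin_free (path_graph 5).
Proof. by twin_free_5. Qed.

Lemma compl_path5_twin_free : twin_free (compl_graph (path_graph 5)).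
Proof. by twin_free_5. Qed.

Lemma cycle5_twin_free : twin_free (cycle_graph 5).
Proof. by twin_free_5. Qed.

(* Distinctness of the vertices of an induced copy is automatic when the copied
   graph has no twins. *)
Lemma contains_induced_seq (G : sgraph) n (H : rel 'I_n) (Hs : symmetric H)
    (Hi : irreflexive H) (x0 : G) (s : seq G) :
  twin_free (SGraph Hs Hi) ->
  (forall i j : 'I_n, i < j -> adj (nth x0 s i) (nth x0 s j) = H i j) ->
  contains_induced (SGraph Hs Hi) G.
Proof.
move=> tf E.
have E' (i j : 'I_n) : adj (nth x0 s i) (nth x0 s j) = H i j.
  case: (ltngtP i j) => [lt_ij|lt_ji|/val_inj ->]; first exact: E.
  - by rewrite adj_sym E //= Hs.
  - by rewrite adj_irr Hi.
exists (fun i : 'I_n => nth x0 s i); split=> // i j eq_ij.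
by apply: tf => k; rewrite /= -!E' eq_ij.
Qed.

Section FiveFree.
Variable G : sgraph.
Hypothesis Gfree : five_free G.

Lemma no_P5 (a b c d e : G) :
  adj a b -> adj b c -> adj c d -> adj d e ->
  ~~ adj a c -> ~~ adj a d -> ~~ adj a e -> ~~ adj b d -> ~~ adj b e ->
  ~~ adj c e -> False.
Proof.
move=> ab bc cd de ac ad ae bd be ce; case: Gfree => + _ _; apply.
apply: (@contains_induced_seq _ _ _ _ _ a [:: a; b; c; d; e] path5_twin_free).
by move=> [[|[|[|[|[|i]]]]] Hi] // [[|[|[|[|[|j]]]]] Hj] //= _;
  rewrite /path_adj /=; first [assumption | apply/negbTE].
Qed.

Lemma no_C5 (a b c d e : G) :
  adj a b -> adj b c -> adj c d -> adj d e -> adj e a ->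
  ~~ adj a c -> ~~ adj a d -> ~~ adj b d -> ~~ adj b e -> ~~ adj c e -> False.
Proof.
rewrite [adj e a]adj_sym => ab bc cd de ae ac ad bd be ce; case: Gfree => _ _.
apply.
apply: (@contains_induced_seq _ _ _ _ _ a [:: a; b; c; d; e] cycle5_twin_free).
by move=> [[|[|[|[|[|i]]]]] Hi] // [[|[|[|[|[|j]]]]] Hj] //= _;
  rewrite /cycle_adj /=; first [assumption | apply/negbTE].
Qed.

(** The complement of [P5] is a house: here the square [p x q y] with roof [z] over the side
    [x q]. *)
Lemma no_house (p x q y z : G) :
  adj p x -> adj x q -> adj q y -> adj y p -> adj z x -> adj z q ->
  ~~ adj p q -> ~~ adj x y -> ~~ adj z p -> ~~ adj z y -> False.
Proof.
rewrite [adj q y]adj_sym => px xq yq yp zx zq; rewrite [adj p q]adj_sym => qp xy zp zy.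
case: Gfree => _ + _; apply.
(* In the complement the house is the path x - y - z - p - q. *)
apply: (@contains_induced_seq _ _ _ _ _ x [:: x; y; z; p; q] compl_path5_twin_free).
by move=> [[|[|[|[|[|i]]]]] Hi] // [[|[|[|[|[|j]]]]] Hj] //= _;
  rewrite /compl_adj /= /path_adj /=;
  first [assumption | apply/negbTE; assumption | rewrite adj_sym; assumption
        | rewrite adj_sym; apply/negbTE; assumption].
Qed.

End FiveFree.

(** * Passing to the complement *)

Lemma contains_induced_compl (H G : sgraph) :
  contains_induced H (compl_graph G) -> contains_induced (compl_graph H) G.
Proof.
case=> f [finj fE]; exists f; split=> // x y /=; rewrite /compl_adj -fE /=.
rewrite /compl_adj (inj_eq finj) negb_and !negbK.
by case: eqVneq => [->|] //=; rewrite adj_irr.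
Qed.

(** The proof fields consist of boolean equations, so extensionality and [eq_irrelevance] identify
    them. This makes double complementation a plain equality of graphs. *)
Lemma sgraph_eq (V : finType) (e f : rel V) (es : symmetric e) (ei : irreflexive e)
    (fs : symmetric f) (fi : irreflexive f) :
  e =2 f -> SGraph es ei = SGraph fs fi.
Proof.
move=> eq_ef; have {eq_ef} eq_ef : e = f.
  by apply: functional_extensionality => x; apply: functional_extensionality.
move: es ei fs fi; rewrite eq_ef => es ei fs fi; congr SGraph.
  apply: functional_extensionality_dep => x.
  by apply: functional_extensionality_dep => y; apply: eq_irrelevance.
by apply: functional_extensionality_dep => x; apply: eq_irrelevance.
Qed.

Lemma compl_graphK (G : sgraph) : compl_graph (compl_graph G) = G.
Proof.
case: G => V e es ei; apply: sgraph_eq => x y.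
rewrite /compl_adj /= /compl_adj negb_and !negbK.
by case: eqVneq => [->|] //=; rewrite ei.
Qed.

(* Doubling modulo 5 is an isomorphism from C5 to its complement. *)
Lemma contains_compl_cycle5 (G : sgraph) :
  contains_induced (compl_graph (cycle_graph 5)) G ->
  contains_induced (cycle_graph 5) G.
Proof.
case=> f [_ fE]; pose o k : 'I_5 := inord k.
apply: (@contains_induced_seq _ _ _ _ _ (f (o 0))
  [:: f (o 0); f (o 2); f (o 4); f (o 1); f (o 3)] cycle5_twin_free).
move=> [[|[|[|[|[|i]]]]] Hi] // [[|[|[|[|[|j]]]]] Hj] //= _;
 by rewrite fE /= /compl_adj /= /cycle_adj -!val_eqE /= !inordK.
Qed.

(** Complementation swaps [P5] with its complement, and [C5] is self-complementary. *)
Lemma five_free_compl (G : sgraph) : five_free G -> five_free (compl_graph G).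
Proof.
case=> hP hcP hC; split=> /contains_induced_compl //.
- by rewrite compl_graphK.
- by move/contains_compl_cycle5.
Qed.

Lemma compl_adjE (G : sgraph) (x y : G) :
  x != y -> adj (s := compl_graph G) x y = ~~ adj x y.
Proof. by move=> neq; rewrite /= /compl_adj neq. Qed.

Lemma prime_compl (G : sgraph) : prime_graph G -> prime_graph (compl_graph G).
Proof.
move=> pG [S [[S0 hS] cS ST]]; apply: pG; exists S; split=> //; split=> // v vS.
have neq x : x \in S -> v != x by move=> xS; apply: contraNneq vS => ->.
case: (hS v vS) => /forall_inP H; [right | left]; apply/forall_inP => x xS;
  by move: (H x xS); rewrite compl_adjE ?negbK ?neq.
Qed.

(** * Cliques and stable sets *)

Section Cliques.
Variable G : sgraph.
Implicit Types S K : {set G}.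

Lemma cliqueP S :
  reflect {in S &, forall x y, x != y -> adj x y} (clique S).
Proof.
apply: (iffP forall_inP) => [H x y xS yS neq | H x xS].
  by have /forall_inP/(_ y yS)/implyP/(_ neq) := H x xS.
by apply/forall_inP => y yS; apply/implyP; apply: H.
Qed.

Lemma stableP S : reflect {in S &, forall x y, ~~ adj x y} (stable_set S).
Proof.
apply: (iffP forall_inP) => [H x y xS yS | H x xS].
  by have /forall_inP/(_ y yS) := H x xS.
by apply/forall_inP => y yS; apply: H.
Qed.

Lemma cliqueS K S : K \subset S -> clique S -> clique K.
Proof.
by move=> /subsetP sub /cliqueP cS; apply/cliqueP => x y /sub xS /sub; apply: cS.
Qed.

Lemma cliqueU1 x S : clique S -> complete_to x S -> clique (x |: S).
Proof.
move=> /cliqueP cS /forall_inP xS; apply/cliqueP => u v; rewrite !inE.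
case/predU1P=> [->|uS] /predU1P[->|vS]; rewrite ?eqxx // => neq.
- exact: xS.
- by rewrite adj_sym xS.
- exact: cS.
Qed.

End Cliques.

(** * Split graphs by forbidden subgraphs *)

Section SplitGraphs.
Variable G : sgraph.
Hypothesis G2K2 : forall x y u v : G, adj x y -> adj u v ->
  ~~ adj x u -> ~~ adj x v -> ~~ adj y u -> ~~ adj y v -> False.
Hypothesis GC4 : forall x y u v : G, adj x y -> adj y u -> adj u v -> adj v x ->
  x != u -> y != v -> ~~ adj x u -> ~~ adj y v -> False.
Hypothesis GC5 : forall a b c d e : G,
  adj a b -> adj b c -> adj c d -> adj d e -> adj e a ->
  ~~ adj a c -> ~~ adj a d -> ~~ adj b d -> ~~ adj b e -> ~~ adj c e -> False.

Definition degree (x : G) := #|[set y | adj x y]|.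

(* Foldes-Hammer: a maximum clique of largest degree sum has a stable complement. *)
Lemma split_of_forbidden : split_graph G.
Proof.
have cl0 : clique (set0 : {set G}) by apply/cliqueP => x y; rewrite inE.
have [K0 cK0 K0max] := arg_maxnP (fun K : {set G} => #|K|) cl0.
(* [big] singles out the maximum cliques; the degree sum is maximised among these only. *)
pose big (K : {set G}) := clique K && (#|K0| <= #|K|).
have bigK0 : big K0 by rewrite /big cK0 leqnn.
have [K /andP[cK szK] Kmax] :=
  arg_maxnP (fun K : {set G} => \sum_(v in K) degree v) bigK0.
have {}szK (Q : {set G}) : clique Q -> #|Q| <= #|K|.
  by move=> cQ; apply: leq_trans (K0max Q cQ) szK.
have KP := cliqueP _ cK.
have nonnb x : x \notin K -> exists2 u, u \in K & ~~ adj x u.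
  move=> xK; apply/exists_inP; rewrite -negb_forall_in; apply/negP.
  by move/(cliqueU1 cK)/szK; rewrite cardsU1 xK add1n ltnn.
have main x y : x \notin K -> y \notin K -> adj x y ->
    {in K, forall u, ~~ adj x u -> ~~ adj y u} -> False.
  move=> xK yK xy sub; have [u uK xu] := nonnb x xK.
  (* [x] misses only [u] in [K]: two missed vertices would span an edge anticomplete to [x y]. *)
  have xadj v : v \in K -> v != u -> adj x v.
    move=> vK vu; apply/negPn/negP => xv.
    exact: (G2K2 xy (KP _ _ vK uK vu) xv xu (sub _ vK xv) (sub _ uK xu)).
  have cQ : clique (x |: (K :\ u)).
    apply: cliqueU1; first exact: cliqueS (subsetDl _ _) cK.
    by apply/forall_inP => v; rewrite !inE => /andP[vu vK]; apply: xadj.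
  have xKu : x \notin K :\ u by rewrite !inE (negbTE xK) andbF.
  have cardQ : #|x |: (K :\ u)| = #|K|.
    by rewrite cardsU1 xKu (cardsD1 u K) uK.
  (* [y] misses some [v] besides [u], as otherwise replacing [u] by [x] and [y] gives a larger
     clique. *)
  have [v /and3P[vK vu yv]|yadj] :=
      pickP [pred v | [&& v \in K, v != u & ~~ adj y v]]; last first.
    have /szK : clique (y |: (x |: (K :\ u))).
      apply: cliqueU1 cQ _; apply/forall_inP => c; rewrite !inE.
      case/predU1P => [->|/andP[cu cK']]; first by rewrite adj_sym.
      by move: (yadj c); rewrite /= cK' cu => /negbT; rewrite negbK.
    rewrite cardsU1 cardQ !inE (negbTE yK) andbF orbF.
    have -> : y != x by apply: contraTneq xy => ->; rewrite adj_irr.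
    by rewrite add1n ltnn.
  (* Exchanging [u] for [x] gives another maximum clique, so the choice of [K] compares the degrees.
     As [y] is adjacent to [x] but not to [u], some [w] is adjacent to [u] but not to [x]. *)
  have deg_xu : degree x <= degree u.
    have := Kmax (x |: (K :\ u)); rewrite /big cQ cardQ (szK _ cK0) /= => /(_ isT).
    rewrite big_setU1 //= (big_setD1 u uK) /= /geq /=.
    by rewrite leq_add2r.
  have [w /andP[uw xw]|nw] := pickP [pred w | adj u w && ~~ adj x w]; last first.
    move: deg_xu; apply/negP; rewrite -ltnNge.
    apply: proper_card; apply/properP; split.
      apply/subsetP => w; rewrite !inE => uw; move: (nw w).
      by rewrite /= uw => /negbT; rewrite negbK.
    by exists y; rewrite !inE // adj_sym; apply: sub.
  have yu := sub u uK xu; have xv := xadj v vK vu; have uv := KP _ _ uK vK.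
  rewrite eq_sym in uv; move: (uv vu) => {}uv.
  have yw : adj y w.
    apply/negPn/negP => yw; apply: (G2K2 xy uw) => //.
  have [vw|vw] := boolP (adj v w).
    apply: (GC4 xy yw (v := v)); rewrite // 1?adj_sym //.
      by apply: contraNneq xu => ->; rewrite adj_sym.
    by apply: contraNneq yK => ->.
  apply: (GC5 xy yw (d := u) (e := v)); rewrite // 1?adj_sym //.
exists K, (~: K); split=> //; first by rewrite setUCr.
  by rewrite -subsets_disjoint.
apply/stableP => x y; rewrite !inE => xK yK; apply/negP => xy.
(* Either [x] and [y] have nested neighbourhoods in [K], or two private neighbours close a [C4]. *)
have [/forall_inP sub|] := boolP [forall u in K, ~~ adj x u ==> ~~ adj y u].
  by apply: (main x y) => // u uK; apply/implyP/sub.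
rewrite negb_forall_in => /exists_inP[u uK]; rewrite negb_imply negbK => /andP[xu yu].
apply: (main y x) => // [|v vK yv]; first by rewrite adj_sym.
apply/negP => xv; apply: (GC4 xy yu (v := v)); rewrite // 1?adj_sym //.
- by apply: KP => //; apply: contraNneq yv => ->.
- by apply: contraNneq xK => ->.
- by apply: contraNneq yK => ->.
Qed.

End SplitGraphs.

(** * Connected sets and components *)

Section Connectedness.
Variable G : sgraph.
Implicit Types S X : {set G}.

(** Connectedness by cuts, in boolean form so that a largest connected set can be selected by
    [arg_maxnP]. *)
Definition connected S : bool :=
  [forall P : {set G}, forall x in S :&: P, forall y in S :\: P,
    [exists u in S :&: P, exists v in S :\: P, adj u v]].

Lemma connected_cross S (P : pred G) x y :
  connected S -> x \in S -> P x -> y \in S -> ~~ P y ->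
  exists u v, [/\ u \in S, v \in S, P u, ~~ P v & adj u v].
Proof.
move=> /forallP/(_ [set z | P z])/forall_inP/(_ x) + xS Px yS Py.
rewrite !inE xS Px => /(_ isT)/forall_inP/(_ y).
rewrite !inE Py yS => /(_ isT)/exists_inP[u]; rewrite !inE => /andP[uS Pu].
case/exists_inP=> v; rewrite !inE => /andP[Pv vS] uv.
by exists u, v.
Qed.

Lemma connectedI S :
  (forall (P : pred G) x y, x \in S -> P x -> y \in S -> ~~ P y ->
    exists u v, [/\ u \in S, v \in S, P u, ~~ P v & adj u v]) -> connected S.
Proof.
move=> H; apply/forallP => P; apply/forall_inP => x; rewrite !inE => /andP[xS xP].
apply/forall_inP => y; rewrite !inE => /andP[yP yS].
have [u [v [uS vS uP vP uv]]] := H (mem P) x y xS xP yS yP.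
by apply/exists_inP; exists u; rewrite ?inE ?uS //;
  apply/exists_inP; exists v; rewrite ?inE ?vS ?andbT.
Qed.

Lemma connectedU1 v x X : connected X -> x \in X -> adj v x -> connected (v |: X).
Proof.
move=> cX xX vx; apply: connectedI => P y z yX Py zX Pz.
have [/existsP[p /andP[pX Pp]]|noP] := boolP [exists p, (p \in X) && P p].
  have [/existsP[q /andP[qX Pq]]|noN] := boolP [exists q, (q \in X) && ~~ P q].
    have [u [w [uX wX Pu Pw uw]]] := connected_cross cX pX Pp qX Pq.
    by exists u, w; rewrite !inE uX wX !orbT.
  have allP q : q \in X -> P q.
    by move=> qX; apply: contraNT noN => Pq; apply/existsP; exists q; rewrite qX.
  have Pv : ~~ P v.
    by move: zX; rewrite !inE => /predU1P[<- //|/allP]; rewrite (negbTE Pz).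
  by exists x, v; rewrite !inE eqxx xX orbT Pv allP // adj_sym.
have allN q : q \in X -> ~~ P q.
  by move=> qX; apply: contraNN noP => Pq; apply/existsP; exists q; rewrite qX.
have Pv : P v.
  by move: yX; rewrite !inE => /predU1P[<- //|/allN]; rewrite Py.
by exists v, x; rewrite !inE eqxx xX orbT Pv allN.
Qed.

Lemma connected_edge x y : adj x y -> connected [set x; y].
Proof.
move=> xy; apply: (@connectedU1 x y); rewrite ?inE //.
by apply: connectedI => P u v; rewrite !inE => /eqP-> Py /eqP->; rewrite Py.
Qed.

Definition comp S x : {set G} := [set y | connect [rel u v in S | adj u v] x y].

Lemma comp_refl S x : x \in comp S x.
Proof. by rewrite inE connect0. Qed.

Lemma comp_sub S x y : x \in S -> y \in comp S x -> y \in S.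
Proof.
move=> xS; rewrite inE => /connectP[p]; elim/last_ind: p => [_ -> //|p z _].
by rewrite rcons_path last_rcons => /andP[_ /andP[/andP[_ ?] _]] ->.
Qed.

Lemma comp_step S x y z :
  y \in comp S x -> y \in S -> z \in S -> adj y z -> z \in comp S x.
Proof.
rewrite !inE => xy yS zS yz; apply: connect_trans xy (connect1 _).
by rewrite /= yS zS.
Qed.

Lemma comp_cross S x (P : pred G) y :
  y \in comp S x -> P x != P y ->
  exists u v, [/\ u \in comp S x, v \in comp S x, u \in S, v \in S & adj u v && (P u != P v)].
Proof.
rewrite inE => /connectP[p]; elim/last_ind: p y => [y _ -> /eqP //|p z IH y].
rewrite rcons_path last_rcons => /andP[pp /andP[/andP[lS zS] lz]] -> {y} Pxz.
have lc : last x p \in comp S x by rewrite inE; apply/connectP; exists p.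
have [eqP|neqP] := eqVneq (P x) (P (last x p)); last exact: IH pp erefl neqP.
exists (last x p), z; split=> //; last by rewrite lz -eqP.
exact: comp_step lc lS zS lz.
Qed.

Lemma comp_ind S x (P : pred G) :
  (forall u v, u \in comp S x -> u \in S -> v \in S -> adj u v -> P u = P v) ->
  {in comp S x, forall y, P y = P x}.
Proof.
move=> H y yc; apply/eqP; rewrite eq_sym; apply/negPn/negP => neqP.
have [u [v [uc vc uS vS /andP[uv]]]] := comp_cross yc neqP.
by rewrite (H u v) ?eqxx.
Qed.

Lemma comp_connected S x : connected (comp S x).
Proof.
apply: connectedI => P y z yc Py zc Pz.
have [w wc neqP] : exists2 w, w \in comp S x & P x != P w.
  have [Px|Px] := boolP (P x); [by exists z; rewrite // (negbTE Pz)|].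
  by exists y; rewrite // Py.
have [u [v [uc vc uS vS /andP[uv]]]] := comp_cross wc neqP.
case: (boolP (P u)) => Pu; case: (boolP (P v)) => Pv // _.
  by exists u, v.
by exists v, u; rewrite adj_sym.
Qed.

End Connectedness.

(** * The classes of vertices around a set *)

Section NeighbourClasses.
Variable G : sgraph.
Implicit Types X : {set G}.

Definition nonnbrs X := [set v | (v \notin X) && anticomplete_to v X].
Definition fullnbrs X := [set v | (v \notin X) && complete_to v X].
Definition mixnbrs X := [set v | (v \notin X) && mixed_on v X].
Definition active X := [set v in nonnbrs X | [exists w in nonnbrs X, adj v w]].

Lemma mixedP v X :
  reflect ((exists2 x, x \in X & adj v x) /\ (exists2 x, x \in X & ~~ adj v x))
          (mixed_on v X).
Proof.
rewrite /mixed_on /complete_to /anticomplete_to !negb_forall_in.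
apply: (iffP andP) => [[/exists_inP[x xX vx] /exists_inP[y yX]]|[[x xX vx] [y yX vy]]].
  by rewrite negbK; split; [exists y | exists x].
by split; apply/exists_inP; [exists y | exists x; rewrite ?negbK].
Qed.

Lemma nonnbrsP v X :
  reflect (v \notin X /\ {in X, forall x, ~~ adj v x}) (v \in nonnbrs X).
Proof. by rewrite inE; apply: (iffP andP) => -[? /forall_inP]. Qed.

Lemma fullnbrsP v X :
  reflect (v \notin X /\ {in X, forall x, adj v x}) (v \in fullnbrs X).
Proof. by rewrite inE; apply: (iffP andP) => -[? /forall_inP]. Qed.

Lemma mixnbrsP v X :
  reflect [/\ v \notin X, exists2 x, x \in X & adj v x
                        & exists2 x, x \in X & ~~ adj v x] (v \in mixnbrs X).
Proof.
rewrite inE; apply: (iffP andP) => [[? /mixedP[]]|[? ? ?]] //.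
by split=> //; apply/mixedP.
Qed.

Lemma activeP v X :
  reflect (v \in nonnbrs X /\ exists2 w, w \in nonnbrs X & adj v w) (v \in active X).
Proof.
rewrite [v \in active X]inE; apply: (iffP andP) => -[vN H]; split=> //; exact/exists_inP.

Qed.

Lemma nbr_classes v X :
  v \notin X -> [|| v \in nonnbrs X, v \in fullnbrs X | v \in mixnbrs X].
Proof.
by move=> vX; rewrite !inE vX /= /mixed_on; case: complete_to; case: anticomplete_to.
Qed.

End NeighbourClasses.

(** * Attachments to a connected set *)

Section ConnectedSets.
Variable G : sgraph.
Hypothesis Gfree : five_free G.
Implicit Types (X L : {set G}) (l y : G).

(** [R] marks what [l] reaches within two steps through [X]. If [R] is not all of [X], an edge [u v]
    of [X] leaves it, and [y l w u v] is an induced [P5]. *)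
Lemma connected_dominated X y l :
  connected X -> {in X, forall x, ~~ adj y x} -> adj y l ->
  (exists2 x, x \in X & adj l x) ->
  {in X, forall x, ~~ adj l x -> exists2 w, w \in X & adj l w && adj w x}.
Proof.
move=> cX yX yl [x0 x0X lx0] x xX lx.
pose R z := adj l z || [exists w in X, adj l w && adj w z].
have [Rx|Rx] := boolP (R x).
  by move: Rx; rewrite /R (negbTE lx) => /exists_inP[w wX ?]; exists w.
have Rx0 : R x0 by rewrite /R lx0.
have [u [v [uX vX Ru Rv uv]]] := connected_cross cX x0X Rx0 xX Rx.
move: Rv; rewrite /R negb_or negb_exists_in => /andP[lv /forall_inP nv].
have lu : ~~ adj l u by apply: contraL (nv u uX) => lu; rewrite lu uv.
move: Ru; rewrite /R (negbTE lu) => /exists_inP[w wX /andP[lw wu]].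
have wv : ~~ adj w v by have := nv w wX; rewrite lw.
by case: (@no_P5 _ Gfree y l w u v) => //; apply: yX.
Qed.

(** If [x] sees [l'] but not [l], pick [w] in [X] adjacent to [l] and [x]: then [y], [l], [w], [x],
    [l'] induce a house or a [C5], according to whether [l'] sees [w]. *)
Lemma nonadj_agree X y l l' :
  connected X -> {in X, forall x, ~~ adj y x} -> adj y l -> adj y l' ->
  ~~ adj l l' ->
  (exists2 x, x \in X & adj l x) -> (exists2 x, x \in X & adj l' x) ->
  {in X, forall x, adj l x = adj l' x}.
Proof.
move=> cX yX; move: l l'.
have main l l' : adj y l -> adj y l' -> ~~ adj l l' ->
    (exists2 x, x \in X & adj l x) -> {in X, forall x, adj l' x -> adj l x}.
  move=> yl yl' ll' hl x xX l'x; apply/negPn/negP => lx.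
  have [w wX /andP[lw wx]] := connected_dominated cX yX yl hl xX lx.
  have [yw yx] := (yX w wX, yX x xX).
  have [l'w|l'w] := boolP (adj l' w).
    by case: (@no_house _ Gfree l w l' y x); rewrite // 1?adj_sym.
  by case: (@no_C5 _ Gfree l w x l' y); rewrite // 1?adj_sym.
move=> l l' yl yl' ll' hl hl' x xX; apply/idP/idP; last exact: main.
by apply: main => //; rewrite adj_sym.
Qed.

(* A vertex of [X] with the most neighbours in [L] is complete to [L]: a missed
   [l] has a neighbour [w] next to it, and [w] sees strictly more of [L]. *)
Lemma connected_helly X L y :
  connected X -> X != set0 -> {in X, forall x, ~~ adj y x} ->
  {in L, forall l, adj y l} -> clique L ->
  {in L, forall l, exists2 x, x \in X & adj l x} ->
  exists2 x, x \in X & complete_to x L.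
Proof.
move=> cX /set0Pn[x0 x0X] yX yL /cliqueP cL hL.
have [a aX amax] := arg_maxnP (fun x : G => #|[set l in L | adj x l]|) x0X.
exists a => //; apply/forall_inP => l lL; apply/negPn/negP => al.
have la : ~~ adj l a by rewrite adj_sym.
have [w wX /andP[lw wa]] := connected_dominated cX yX (yL l lL) (hL l lL) aX la.
have := amax w wX; apply/negP; rewrite /geq /= -ltnNge; apply: proper_card.
apply/properP; split; last by exists l; rewrite inE lL //= adj_sym.
apply/subsetP => l'; rewrite !inE => /andP[l'L al']; rewrite l'L /=.
(* A neighbour [l'] of [a] missed by [w] would give the square [w l l' a] with roof [y]. *)
apply/negPn/negP => wl'.
have neq : l != l' by apply: contraNneq wl' => <-; rewrite adj_sym.
have [yw ya] := (yX w wX, yX a aX).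
have [yl yl'] := (yL l lL, yL l' l'L).
have ll' := cL _ _ lL l'L neq.
by case: (@no_house _ Gfree w l l' a y); rewrite // adj_sym.
Qed.

End ConnectedSets.

(** Agreement on the non-edges of [S] spreads along paths of the complement. *)
Lemma uniform_on_anticomponent (G : sgraph) (S K : {set G}) (c : G) :
  {in S &, forall b b', b != b' -> ~~ adj b b' -> adj c b = adj c b'} ->
  anticomponent S K -> ~~ mixed_on c K.
Proof.
move=> H [x xS ->]; apply/mixedP => -[[u uK cu] [v vK cv]].
have E := @comp_ind (compl_graph G) S x (adj c).
have {}E : {in @comp (compl_graph G) S x, forall y, adj c y = adj c x}.
  apply: E => a b _ aS bS /andP[neq nab]; exact: H.
by move: cv; rewrite (E v vK) -(E u uK) cu.
Qed.

(** * Assembling a split divide around a connected set *)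

Section DivideAround.
Variable G : sgraph.
Hypothesis Gprime : prime_graph G.
Hypothesis Gfree : five_free G.
Variable X : {set G}.
Hypothesis Xconn : connected X.
Hypothesis Xcard : 2 <= #|X|.

Lemma mixnbrs_neq0 : X != [set: G] -> mixnbrs X != set0.
Proof.
move=> XT; apply/negP => /eqP L0; apply: Gprime; exists X; split=> //; split.
  by apply: contraTneq Xcard => ->; rewrite cards0.
move=> v vX; have : v \notin mixnbrs X by rewrite L0 inE.
rewrite inE vX /mixed_on /= negb_and !negbK.
by case/orP; [left | right].
Qed.

(** No maximality of [X] is assumed, so this serves both in [G] and in its complement. The other
    conditions follow: [connected_helly], seen from [c0], gives a vertex of [X] complete to [L],
    primality makes [L] non-empty, and [c0] with a neighbour puts two vertices in [C]. *)
Lemma divide_around c0 :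
  c0 \in active X -> clique (mixnbrs X) ->
  {in mixnbrs X & fullnbrs X, forall l b, adj l b} ->
  {in mixnbrs X & active X, forall l c, adj l c} ->
  (exists2 c, c \in active X & complete_to c (fullnbrs X)) ->
  (forall c b b', c \in active X -> b \in fullnbrs X -> b' \in fullnbrs X ->
     b != b' -> ~~ adj b b' -> adj c b = adj c b') ->
  admits_split_divide G.
Proof.
move=> c0C cL LB LC hc hmix.
have X0 : X != set0 by apply: contraTneq Xcard => ->; rewrite cards0.
have [x0 x0X] := set0Pn _ X0.
have /activeP[/nonnbrsP[c0X c0anti] [c1 c1M c01]] := c0C.
have c1C : c1 \in active X.
  apply/activeP; split=> //; exists c0; last by rewrite adj_sym.
  by apply/nonnbrsP.
exists X, (fullnbrs X), (active X), (mixnbrs X), (nonnbrs X :\: active X).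
have FN v : v \in fullnbrs X -> v \in nonnbrs X -> False.
  case/fullnbrsP=> _ /(_ _ x0X) vx /nonnbrsP[_ /(_ _ x0X)]; by rewrite vx.
have FM v : v \in fullnbrs X -> v \in mixnbrs X -> False.
  case/fullnbrsP=> _ vX /mixnbrsP[_ _ [x xX]]; by rewrite vX.
have NM v : v \in nonnbrs X -> v \in mixnbrs X -> False.
  case/nonnbrsP=> _ vX /mixnbrsP[_ [x xX] + _]; by rewrite (negbTE (vX x xX)).
have AN v : v \in active X -> v \in nonnbrs X by case/activeP.
split=> //.
- apply/setP => v; rewrite in_setT 4!in_setU in_setD.
  have [vX|vX] := boolP (v \in X); rewrite ?orTb //=.
  by have /or3P[] := nbr_classes vX => ->; rewrite ?orbT //; case: (v \in active X);
    rewrite ?orbT.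
- have disj (S S' : {set G}) : (forall v, v \in S -> v \in S' -> False) -> [disjoint S & S'].
    move=> H; apply/pred0P => v /=; apply/negP => /andP[]; exact: H.
  rewrite /= !andbT; do ![apply/andP; split]; apply: disj => v.
  + by move=> vX /fullnbrsP[]; rewrite vX.
  + by move=> vX /AN/nonnbrsP[]; rewrite vX.
  + by move=> vX /mixnbrsP[]; rewrite vX.
  + by move=> vX /setDP[/nonnbrsP[]]; rewrite vX.
  + by move=> vF /AN; apply: FN.
  + exact: FM.
  + by move=> vF /setDP[+ _]; apply: FN.
  + by move=> /AN; apply: NM.
  + by move=> vA /setDP[]; rewrite vA.
  + by move=> vM /setDP[vN _]; apply: NM vN vM.
- apply/forall_inP => x xX; apply/forall_inP => b /fullnbrsP[_ /(_ x xX)].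
  by rewrite adj_sym.
- apply/forall_inP => x xX; apply/forall_inP => v.
  rewrite in_setU in_setD => hv; have /nonnbrsP[_ /(_ x xX)] : v \in nonnbrs X.
    by case/orP: hv => [/AN|/andP[]].
  by rewrite adj_sym.
- apply: (@connected_helly _ Gfree X _ c0) => // [l lL|l /mixnbrsP[]//].
  by rewrite adj_sym LC.
- by apply: mixnbrs_neq0; apply: contraNneq c0X => ->.
- by move=> l; rewrite inE => /andP[].
- apply/forall_inP => l lL; apply/forall_inP => v; rewrite in_setU => /orP[].
    exact: LB.
  exact: LC.
- have neq : c0 != c1 by apply: contraTneq c01 => ->; rewrite adj_irr.
  have -> : 2 = #|[set c0; c1]| by rewrite cards2 neq.
  by apply/subset_leq_card/subsetP => c /set2P[->|->].
- move=> c K cC; apply: uniform_on_anticomponent => b b'; exact: hmix.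
- apply/stableP => u v /setDP[uN uA] /setDP[vN vA]; apply/negP => uv.
  by case/negP: uA; apply/activeP; split=> //; exists v.
- apply/forall_inP => u /setDP[uN uA]; apply/forall_inP => v /AN vN; apply/negP => uv.
  by case/negP: uA; apply/activeP; split=> //; exists v.
Qed.

End DivideAround.

(** * Choosing a maximal connected set *)

Lemma mixed_uniform (G : sgraph) (X : {set G}) (l c c' : G) :
  five_free G -> connected X -> l \in mixnbrs X ->
  c \in nonnbrs X -> c' \in nonnbrs X -> adj c c' -> adj l c = adj l c'.
Proof.
move=> Gfree cX /mixnbrsP[_ [x xX lx] [x' x'X lx']].
(* This edge of [X], with [l] adjacent to [u] only, extends through [l] to an induced [P5] as soon
   as [l] distinguishes the ends of an edge [d d']. *)
have [u [v [uX vX lu lv uv]]] := connected_cross cX xX lx x'X lx'.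
have main d d' : d \in nonnbrs X -> d' \in nonnbrs X -> adj d d' -> adj l d -> adj l d'.
  move=> /nonnbrsP[_ dX] /nonnbrsP[_ d'X] dd' ld; apply/negPn/negP => ld'.
  by case: (@no_P5 _ Gfree v u l d d'); rewrite // 1?adj_sym ?dX ?d'X.
move=> cN c'N cc'; apply/idP/idP; apply: main => //; by rewrite adj_sym.
Qed.

(** If [w] missed both ends of an edge among the non-neighbours of a largest such [X], then [w |: X]
    would still be connected and leave that edge untouched. *)
Lemma exists_maximal_connected (G : sgraph) (x y u v : G) :
  adj x y -> adj u v -> ~~ adj x u -> ~~ adj x v -> ~~ adj y u -> ~~ adj y v ->
  exists X : {set G}, [/\ connected X, 2 <= #|X|, exists c, c \in active X
    & forall w m m', w \notin X -> (exists2 z, z \in X & adj w z) ->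
      m \in nonnbrs X -> m' \in nonnbrs X -> adj m m' -> adj w m || adj w m'].
Proof.
move=> xy uv xu xv yu yv; pose good (X : {set G}) := connected X && (active X != set0).
have nonnb w z : adj w z -> ~~ adj x w -> ~~ adj y w -> ~~ adj x z -> ~~ adj y z ->
    w \in nonnbrs [set x; y].
  move=> wz xw yw xz yz; apply/nonnbrsP; split.
    by apply/negP => /set2P[] E; move: xz yz; rewrite -E wz.
  by move=> p /set2P[->|->]; rewrite adj_sym.
have good0 : good [set x; y].
  rewrite /good connected_edge //=; apply/set0Pn; exists u; apply/activeP.
  by split; [apply: (nonnb u v) | exists v; rewrite // (nonnb v u) // adj_sym].
have [X /andP[cX /set0Pn aX] Xmax] := arg_maxnP (fun X : {set G} => #|X|) good0.
exists X; split=> //.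
  apply: leq_trans (Xmax _ good0); rewrite cards2.
  by have -> : x != y by apply: contraTneq xy => ->; rewrite adj_irr.
move=> w m m' wX [z zX wz] /nonnbrsP[mX mN] /nonnbrsP[m'X m'N] mm'.
apply/negPn; rewrite negb_or; apply/negP => /andP[wm wm'].
suff /Xmax : good (w |: X) by rewrite /geq /= cardsU1 wX add1n ltnn.
rewrite /good (connectedU1 cX zX wz) /=; apply/set0Pn; exists m.
have inN p q : p \notin X -> {in X, forall z, ~~ adj p z} -> ~~ adj w p -> ~~ adj w q ->
    adj p q -> p \in nonnbrs (w |: X).
  move=> pX pN wp wq pq; apply/nonnbrsP; split.
    by rewrite !inE negb_or pX andbT; apply: contraNneq wq => <-.
  by move=> r; rewrite !inE => /predU1P[->|/pN //]; rewrite adj_sym.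
apply/activeP; split; first exact: (inN m m').
by exists m' => //; apply: (inN m' m); rewrite // adj_sym.
Qed.

(** * Neighbour classes in the complement *)

Section ComplementClasses.
Variable G : sgraph.
Variable X : {set G}.

Lemma nonnbrs_compl : nonnbrs (G := compl_graph G) X = fullnbrs (G := G) X.
Proof.
apply/setP => v; rewrite !inE; apply: andb_id2l => vX; apply: eq_forallb_in => x xX.
by rewrite compl_adjE ?negbK //; apply: contraNneq vX => ->.
Qed.

Lemma fullnbrs_compl : fullnbrs (G := compl_graph G) X = nonnbrs (G := G) X.
Proof.
apply/setP => v; rewrite !inE; apply: andb_id2l => vX; apply: eq_forallb_in => x xX.
by rewrite compl_adjE //; apply: contraNneq vX => ->.
Qed.

Lemma mixnbrs_compl : mixnbrs (G := compl_graph G) X = mixnbrs (G := G) X.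
Proof.
apply/setP => v; move: nonnbrs_compl fullnbrs_compl => /setP/(_ v) + /setP/(_ v).
rewrite !inE /mixed_on.
by case: (v \in X) => //= -> ->; rewrite andbC.
Qed.

End ComplementClasses.

(** * The classes around a maximal connected set *)

Section MaximalConnected.
Variable G : sgraph.
Hypothesis Gprime : prime_graph G.
Hypothesis Gfree : five_free G.
Variable X : {set G}.
Hypothesis Xconn : connected X.
Hypothesis Xcard : 2 <= #|X|.
Variable c0 : G.
Hypothesis c0C : c0 \in active X.
Hypothesis Xcover : forall w m m', w \notin X -> (exists2 z, z \in X & adj w z) ->
  m \in nonnbrs X -> m' \in nonnbrs X -> adj m m' -> adj w m || adj w m'.

Local Notation B := (fullnbrs X).
Local Notation L := (mixnbrs X).
Local Notation C := (active X).
Local Notation T := (nonnbrs X :\: active X).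

Lemma X_inhabited : exists x, x \in X.
Proof. by apply/set0Pn; apply: contraTneq Xcard => ->; rewrite cards0. Qed.

(** By [Xcover], [l] sees an end of an edge at [c], and by [mixed_uniform] it then sees both. *)
Lemma mix_active l c : l \in L -> c \in C -> adj l c.
Proof.
move=> lL /activeP[cN [c' c'N cc']].
have /mixnbrsP[lX lx _] := lL.
have := Xcover lX lx cN c'N cc'.
by rewrite -(mixed_uniform Gfree Xconn lL cN c'N cc') orbb.
Qed.

Lemma full_nbr b : b \in B -> exists2 x, x \in X & adj b x.
Proof. by case/fullnbrsP=> _ bX; have [x xX] := X_inhabited; exists x; rewrite ?bX. Qed.

Lemma active_anti c : c \in C -> {in X, forall x, ~~ adj c x}.
Proof. by case/activeP=> /nonnbrsP[]. Qed.

(** If non-adjacent, [l] and [b] have a common neighbour in [C], so they agree on [X]; but [b] is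
    complete to [X] and [l] is not. *)
Lemma mix_full l b : l \in L -> b \in B -> adj l b.
Proof.
move=> lL bB; apply/negPn/negP => lb.
have /activeP[c0N [c1 c1N c01]] := c0C.
have c1C : c1 \in C by apply/activeP; split=> //; exists c0; rewrite // adj_sym.
have [bX bfull] := fullnbrsP _ _ bB.
have [c cC bc] : exists2 c, c \in C & adj b c.
  by case/orP: (Xcover bX (full_nbr bB) c0N c1N c01); [exists c0 | exists c1].
have /mixnbrsP[lX hl [x xX]] := lL.
rewrite (nonadj_agree Gfree Xconn (active_anti cC) _ _ lb hl (full_nbr bB)) //.
- by rewrite bfull.
- by rewrite adj_sym mix_active.
- by rewrite adj_sym.
Qed.

Lemma mix_agree l l' : l \in L -> l' \in L -> ~~ adj l l' ->
  {in X, forall x, adj l x = adj l' x}.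
Proof.
move=> lL l'L ll'; have [/mixnbrsP[_ hl _] /mixnbrsP[_ hl' _]] := (lL, l'L).
by apply: (nonadj_agree Gfree Xconn (active_anti c0C)); rewrite // adj_sym mix_active.
Qed.

(** If [c] sees [b] but not [b'], then [b'] sees a neighbour [c'] of [c], and these four with any
    [x] in [X] induce a house or a [C5]. *)
Lemma active_full_agree c b b' : c \in C -> b \in B -> b' \in B ->
  b != b' -> ~~ adj b b' -> adj c b = adj c b'.
Proof.
move=> cC; have /activeP[cN [c' c'N cc']] := cC; have [x xX] := X_inhabited; move: b b'.
have main b b' : b \in B -> b' \in B -> ~~ adj b b' -> adj c b -> adj c b'.
  move=> bB b'B bb' cb; apply/negPn/negP => cb'.
  have [/fullnbrsP[bX /(_ x xX) bx] /fullnbrsP[b'X /(_ x xX) b'x]] := (bB, b'B).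
  have [/nonnbrsP[_ /(_ x xX) cx] /nonnbrsP[_ /(_ x xX) c'x]] := (cN, c'N).
  have := Xcover b'X (full_nbr b'B) cN c'N cc'.
  rewrite adj_sym (negbTE cb') /= => b'c'.
  have [bc'|bc'] := boolP (adj b c').
    by case: (@no_house _ Gfree b' c' b x c); rewrite // 1?adj_sym.
  by case: (@no_C5 _ Gfree b c c' b' x); rewrite // 1?adj_sym.
move=> b b' bB b'B _ bb'; apply/idP/idP; first exact: main.
by apply: main; rewrite // adj_sym.
Qed.

(** Take [c] with the most neighbours in [B]. If it misses [b], a neighbour [c'] of [c] sees [b] by
    [Xcover] and also all that [c] sees in [B], against maximality. *)
Lemma active_helly : exists2 c, c \in C & complete_to c B.
Proof.
have [x xX] := X_inhabited.
have [c cC cmax] := arg_maxnP (fun c : G => #|[set b in B | adj c b]|) c0C.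
exists c => //; apply/forall_inP => b bB; apply/negPn/negP => cb.
have /activeP[cN [c' c'N cc']] := cC.
have c'C : c' \in C by apply/activeP; split=> //; exists c; rewrite // adj_sym.
have /fullnbrsP[bX /(_ x xX) bx] := bB.
have [/nonnbrsP[_ /(_ x xX) cx] /nonnbrsP[_ /(_ x xX) c'x]] := (cN, c'N).
have := Xcover bX (full_nbr bB) cN c'N cc'.
rewrite adj_sym (negbTE cb) /= => bc'.
have := cmax c' c'C; apply/negP; rewrite /geq /= -ltnNge; apply: proper_card.
apply/properP; split; last by exists b; rewrite in_set bB //= adj_sym.
apply/subsetP => b'; rewrite in_set => /andP[b'B cb']; rewrite in_set b'B /=.
apply/negPn/negP => c'b'.
have neq : b' != b by apply: contraNneq cb => <-.
have /fullnbrsP[b'X /(_ x xX) b'x] := b'B.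
have [bb'|bb'] := boolP (adj b' b); last first.
  by move: cb; rewrite -(active_full_agree cC b'B bB neq bb') cb'.
by case: (@no_house _ Gfree c b' b c' x); rewrite // adj_sym.
Qed.

Lemma divide_of_clique : clique L -> admits_split_divide G.
Proof.
move=> cL; apply: (divide_around Gprime Gfree Xconn Xcard c0C cL).
- exact: mix_full.
- exact: mix_active.
- exact: active_helly.
- exact: active_full_agree.
Qed.

(** * Anticomponents of the neighbourhood of [X] *)

Local Notation N := (fullnbrs X :|: mixnbrs X).

Definition antic (x : G) : {set G} := comp (G := compl_graph G) N x.

Definition candidate x :=
  [&& x \in N, 2 <= #|antic x| & [forall d in antic x, forall c in C, adj d c]].

Definition missed x : {set G} := [set t in T | ~~ complete_to t (antic x)].

Lemma T_anti_X t a : t \in T -> a \in X -> ~~ adj t a.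
Proof. by case/setDP=> /nonnbrsP[_ H] _; apply: H. Qed.

Lemma T_anti_CT t v : t \in T -> v \in nonnbrs X -> ~~ adj t v.
Proof.
move=> /setDP[tN tC] vN; apply/negP => tv; case/negP: tC; apply/activeP.
by split=> //; exists v.
Qed.

Lemma five_classes v : [|| v \in X, v \in N, v \in C | v \in T].
Proof.
have [//|vX] := boolP (v \in X).
rewrite in_setU in_setD; have /or3P[] := nbr_classes vX => ->; rewrite ?orbT //=.
by case: (v \in active X); rewrite ?orbT.
Qed.

Lemma N_notin_X v : v \in N -> v \notin X.
Proof. by case/setUP => [/fullnbrsP[]|/mixnbrsP[]]. Qed.

Lemma antic_sub x d : x \in N -> d \in antic x -> d \in N.
Proof. exact: (comp_sub (G := compl_graph G)). Qed.

Lemma antic_refl x : x \in antic x.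
Proof. exact: (comp_refl (G := compl_graph G)). Qed.

Lemma antic_step x y z : y \in antic x -> y \in N -> z \in N ->
  y != z -> ~~ adj y z -> z \in antic x.
Proof.
move=> yD yN zN neq yz; apply: (comp_step (G := compl_graph G) yD yN zN).
by rewrite compl_adjE.
Qed.

Lemma antic_ind x (P : pred G) :
  (forall u v, u \in antic x -> u \in N -> v \in N -> u != v -> ~~ adj u v ->
     P u = P v) ->
  {in antic x, forall y, P y = P x}.
Proof.
move=> H; apply: (comp_ind (G := compl_graph G)) => u v uD uN vN /andP[neq uv].
exact: H.
Qed.

Lemma antic_out x d v : x \in N -> d \in antic x -> v \in N -> v \notin antic x ->
  adj v d.
Proof.
move=> xN dD vN vD; apply/negPn/negP => vd; apply: (negP vD).
apply: antic_step (dD) (antic_sub xN dD) vN _ _; last by rewrite adj_sym.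
by apply: contraNneq vD => <-.
Qed.

(** By [mix_full] a non-edge of [N] lies inside [B] or inside [L]; its ends agree on [X] trivially
    in the first case, by [mix_agree] in the second. *)
Lemma antic_X x a : a \in X -> {in antic x, forall d, adj a d = adj a x}.
Proof.
move=> aX; apply: antic_ind => u v _ uN vN _ uv.
case/setUP: uN => uN; case/setUP: vN => vN.
- have [[_ uX] [_ vX]] := (fullnbrsP _ _ uN, fullnbrsP _ _ vN).
  by rewrite ![adj a _]adj_sym uX ?vX.
- by rewrite adj_sym mix_full in uv.
- by rewrite mix_full in uv.
- by rewrite ![adj a _]adj_sym; apply: mix_agree.
Qed.

(** The anticomponent of a non-edge of [L] stays inside [L], because [L] is complete to [B], and [L]
    is complete to [C]. *)
Lemma nonclique_candidate : ~~ clique L -> exists x, candidate x.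
Proof.
rewrite negb_forall_in => /exists_inP[l lL].
rewrite negb_forall_in => /exists_inP[l' l'L]; rewrite negb_imply => /andP[neq ll'].
have [lN l'N] : l \in N /\ l' \in N by rewrite !in_setU lL l'L !orbT.
have l'D : l' \in antic l.
  by apply: (antic_step (antic_refl l) lN l'N neq ll').
exists l; rewrite /candidate lN /=; apply/andP; split.
  have -> : 2 = #|[set l; l']| by rewrite cards2 neq.
  by apply/subset_leq_card/subsetP => c /set2P[->|->] //; apply: antic_refl.
have DL d : d \in antic l -> d \in L.
  move=> dD; have -> : (d \in L) = (l \in L) => //.
  apply: (antic_ind (P := mem L)) dD => u v _ uN vN _ uv.
  case/setUP: uN => uN; case/setUP: vN => vN /=.
  - have nm w : w \in B -> w \in L = false.
      case/fullnbrsP=> _ wX; apply/negP => /mixnbrsP[_ _ [x xX]]; by rewrite wX.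
    by rewrite !nm.
  - by rewrite adj_sym mix_full in uv.
  - by rewrite mix_full in uv.
  - by rewrite uN vN.
apply/forall_inP => d /DL dL; apply/forall_inP => c; exact: mix_active.
Qed.

(** * The divide of the complement around a minimal candidate *)

Section MinimalCandidate.
Variable x : G.
Hypothesis xcand : candidate x.
Hypothesis xmin : forall y, candidate y -> #|missed x| <= #|missed y|.

Local Notation D := (antic x).

Lemma candidate_in_N : x \in N. Proof. by case/and3P: xcand. Qed.

Lemma D_card : 2 <= #|D|. Proof. by case/and3P: xcand. Qed.

Lemma candidate_in_D : x \in D. Proof. exact: antic_refl. Qed.

Lemma D_connected : connected (G := compl_graph G) D.
Proof. exact: comp_connected. Qed.

Lemma D_C d c : d \in D -> c \in C -> adj c d.
Proof.
by case/and3P: xcand => _ _ /forall_inP H /H/forall_inP h /h; rewrite adj_sym.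
Qed.

Lemma C_full c : c \in C -> c \in fullnbrs D.
Proof.
move=> cC; apply/fullnbrsP; split; last by move=> d dD; apply: D_C.
by apply/negP => cD; have := D_C cD cC; rewrite adj_irr.
Qed.

Lemma N_full v : v \in N -> v \notin D -> v \in fullnbrs D.
Proof.
by move=> vN vD; apply/fullnbrsP; split=> // d dD; apply: (antic_out candidate_in_N).
Qed.

(** No other class can be mixed on [D]: [X] by [antic_X], the rest of [N] by lying in other
    anticomponents, [C] by candidacy. *)
Lemma mix_D_T t : t \in mixnbrs D -> t \in T.
Proof.
case/mixnbrsP=> tD [d dD td] [d' d'D td'].
case/or4P: (five_classes t) => // [tX|tN|tC].
- by move: td'; rewrite (antic_X tX d'D) -(antic_X tX dD) td.
- by rewrite (antic_out candidate_in_N d'D tN tD) in td'.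
- by rewrite D_C in td'.
Qed.

Lemma non_D_XT v : v \in nonnbrs D -> (v \in X) || (v \in T).
Proof.
case/nonnbrsP=> vD /(_ x candidate_in_D) vx; case/or4P: (five_classes v) => [->//|vN|vC|->].
- by rewrite (antic_out candidate_in_N candidate_in_D vN vD) in vx.
- by rewrite (D_C candidate_in_D vC) in vx.
- by rewrite orbT.
Qed.

Lemma X_notin_D a : a \in X -> a \notin D.
Proof.
by move=> aX; apply: contraTN aX => /(antic_sub candidate_in_N)/N_notin_X.
Qed.

Lemma exists_full_X : exists2 a, a \in X & a \in fullnbrs D.
Proof.
have [a aX xa] : exists2 a, a \in X & adj x a.
  by case/setUP: candidate_in_N => [/full_nbr|/mixnbrsP[]].
exists a => //; apply/fullnbrsP; split; first exact: X_notin_D.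
by move=> d dD; rewrite (antic_X aX dD) adj_sym.
Qed.

Lemma X_neqN a d : a \in nonnbrs X -> d \in X -> a != d.
Proof. by case/nonnbrsP=> aX _ dX; apply: contraNneq aX => ->. Qed.

(** This is [mixed_uniform] in the complement, where [fullnbrs D] becomes the set of non-neighbours
    of [D]. *)
Lemma mix_D_uniform t v w : t \in mixnbrs D -> v \in fullnbrs D -> w \in fullnbrs D ->
  v != w -> ~~ adj v w -> adj t v = adj t w.
Proof.
move=> tM vF wF neq vw.
have tneq u : u \in fullnbrs D -> t != u.
  case/fullnbrsP=> _ uD; apply: contraTneq tM => ->.
  by apply/negP => /mixnbrsP[_ _ [d dD]]; rewrite uD.
have := @mixed_uniform (compl_graph G) D t v w (five_free_compl Gfree) D_connected.
rewrite mixnbrs_compl nonnbrs_compl => /(_ tM vF wF).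
rewrite !compl_adjE ?tneq // => /(_ vw); exact: negb_inj.
Qed.

(* If [t] were adjacent to [v], the anticomponent of [v] would be a candidate
   missed by strictly fewer vertices of [T]. *)
Lemma mix_D_active t v w : t \in mixnbrs D -> v \in fullnbrs D -> w \in fullnbrs D ->
  v != w -> ~~ adj v w -> ~~ adj t v.
Proof.
move=> tM vF wF neq vw; have tT := mix_D_T tM; apply/negP => tv.
have tw : adj t w by rewrite -(mix_D_uniform tM vF wF).
have tN u : adj t u -> u \in N.
  move=> tu; case/or4P: (five_classes u) => // [uX|uC|uT].
  - by rewrite (negbTE (T_anti_X tT uX)) in tu.
  - by case/activeP: uC => uN _; rewrite (negbTE (T_anti_CT tT uN)) in tu.
  - by case/setDP: uT => uN _; rewrite (negbTE (T_anti_CT tT uN)) in tu.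
have [vN wN] := (tN v tv, tN w tw).
have /fullnbrsP[vD _] := vF.
have KD u : u \in antic v -> u \notin D.
  move=> uK; suff -> : (u \in D) = (v \in D) by [].
  apply: (antic_ind (P := mem D)) uK => p q _ pN qN npq pq /=.
  apply/idP/idP => [pD|qD]; first exact: antic_step pD pN qN npq pq.
  by apply: antic_step qD qN pN _ _; rewrite 1?eq_sym 1?adj_sym.
have KF u : u \in antic v -> u \in fullnbrs D.
  by move=> uK; apply: N_full (antic_sub vN uK) (KD u uK).
have tK u : u \in antic v -> adj t u.
  move=> uK; have -> : adj t u = adj t v => //.
  apply: (antic_ind (P := adj t)) uK => p q pK pN qN npq pq.
  have qK := antic_step pK pN qN npq pq.
  by apply: mix_D_uniform; rewrite ?KF.
(* A non-edge [u z] would carry the adjacency to [t] from [u] to [z], yet [t] has no neighbour in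
   [nonnbrs X]. Used for [z] in [C] to make [v] a candidate, and for [z] in [T] to compare the
   missed sets. *)
have Kfull u z : u \in antic v -> z \in nonnbrs X -> z \in fullnbrs D -> adj u z.
  move=> uK zN zF; apply/negPn/negP => uz.
  have tz : adj t z.
    rewrite -(mix_D_uniform tM (KF u uK) zF) ?tK //.
    by apply: contraTneq (tK u uK) => ->; apply: T_anti_CT.
  by rewrite (negbTE (T_anti_CT tT zN)) in tz.
have wK : w \in antic v by apply: (antic_step (antic_refl v) vN wN neq vw).
have vcand : candidate v.
  rewrite /candidate vN /=; apply/andP; split.
    have -> : 2 = #|[set v; w]| by rewrite cards2 neq.
    by apply/subset_leq_card/subsetP => c /set2P[->|->] //; apply: antic_refl.
  apply/forall_inP => d dK; apply/forall_inP => c cC.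
  by apply: Kfull (C_full cC) => //; case/activeP: cC.
(* The inclusion of [missed v] in [missed x] is strict because [t] is mixed on [D] but complete to
   [antic v]. *)
have := xmin vcand; apply/negP; rewrite -ltnNge; apply: proper_card.
apply/properP; split; last first.
  exists t; rewrite in_set tT /=.
    by case/mixnbrsP: tM => _ _ [d dD td]; apply/negP => /forall_inP/(_ d dD); apply/negP.
  by rewrite negbK; apply/forall_inP.
apply/subsetP => s; rewrite in_set => /andP[sT]; rewrite in_set sT /=.
apply: contraNN => /forall_inP sD; apply/forall_inP => u uK.
have /setDP[sN _] := sT.
rewrite adj_sym; apply: Kfull => //; apply/fullnbrsP; split=> //.
by apply/negP => sD'; have := sD s sD'; rewrite adj_irr.
Qed.

Lemma codivide : admits_split_divide (compl_graph G).
Proof.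
have [a aX aF] := exists_full_X.
(* The vertex [a] of [X] is complete to [D] and non-adjacent to [c], hence a partner of [c] in the
   complement. *)
have cactive c : c \in C -> c \in active (G := compl_graph G) D.
  move=> cC; have cN : c \in nonnbrs X by case/activeP: cC.
  apply/activeP; rewrite nonnbrs_compl; split; first exact: C_full.
  exists a; rewrite // compl_adjE ?(X_neqN cN) //; exact: active_anti.
have D_act v : v \in active (G := compl_graph G) D ->
    v \in fullnbrs D /\ (forall t, t \in mixnbrs D -> ~~ adj t v).
  case/activeP; rewrite nonnbrs_compl => vF [w wF /andP[neq vw]]; split=> // t tM.
  exact: mix_D_active tM vF wF neq vw.
have MT t : t \in mixnbrs D -> t \in T := @mix_D_T t.
have mneq t v : t \in mixnbrs D -> v \in fullnbrs D -> t != v.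
  move=> tM /fullnbrsP[_ vD]; apply: contraTneq tM => ->.
  by apply/negP => /mixnbrsP[_ _ [d dD]]; rewrite vD.
have mix_non (t v : G) : t \in mixnbrs D -> v \in nonnbrs D ->
    adj (s := compl_graph G) t v.
  move=> tM vN; have tneq : t != v.
    apply: contraTneq tM => ->; apply/negP => /mixnbrsP[_ [d dD vd] _].
    by case/nonnbrsP: vN => _ /(_ d dD); rewrite vd.
  rewrite compl_adjE //; case/orP: (non_D_XT vN) => [vX|/setDP[vN' _]].
    exact: T_anti_X (MT t tM) vX.
  exact: T_anti_CT (MT t tM) vN'.
have mix_act (t v : G) : t \in mixnbrs D -> v \in active (G := compl_graph G) D ->
    adj (s := compl_graph G) t v.
  by move=> tM /D_act[vF /(_ t tM) tv]; rewrite compl_adjE ?mneq.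
have fneq (v w : G) : v \in fullnbrs D -> w \in nonnbrs D -> v != w.
  move=> vF wN; apply: contraTneq vF => ->; apply/negP => /fullnbrsP[_ /(_ x candidate_in_D)].
  by case/nonnbrsP: wN => _ /(_ x candidate_in_D)/negbTE ->.
have c0_non (v : G) : v \in nonnbrs D -> adj (s := compl_graph G) c0 v.
  move=> vN; rewrite compl_adjE ?fneq ?C_full //.
  case/orP: (non_D_XT vN) => [vX|vT]; first exact: active_anti.
  by rewrite adj_sym; apply: T_anti_CT vT _; case/activeP: c0C.
have act_non (y u v : G) : y \in active (G := compl_graph G) D ->
    u \in nonnbrs D -> v \in nonnbrs D -> adj u v -> adj y u = adj y v.
  move=> yA uN vN uv; have [yF yM] := D_act y yA.
  have /fullnbrsP[yD yfull] := yF.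
  (* A vertex of [T] has no neighbour in [X :|: T], so [u] and [v] are in [X]. *)
  have inX p q : p \in nonnbrs D -> q \in nonnbrs D -> adj p q -> p \in X.
    move=> pN qN pq; case/orP: (non_D_XT pN) => // pT.
    case/orP: (non_D_XT qN) => [qX|/setDP[qN' _]].
      by rewrite (negbTE (T_anti_X pT qX)) in pq.
    by rewrite (negbTE (T_anti_CT pT qN')) in pq.
  have {inX} [uX vX] : u \in X /\ v \in X.
    by split; [apply: (inX u v) | apply: (inX v u); rewrite // adj_sym].
  have L0 : mixnbrs D != set0.
    apply: (mixnbrs_neq0 Gprime D_card).
    by apply: contraNneq (X_notin_D aX) => ->.
  have [t tM] := set0Pn _ L0; have tT := MT t tM.
  have /mixnbrsP[_ [d dD td] _] := tM.
  have main p q : p \in X -> q \in X -> p \in nonnbrs D -> q \in nonnbrs D ->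
      adj p q -> adj y p -> adj y q.
    move=> pX qX /nonnbrsP[_ /(_ d dD) pd] /nonnbrsP[_ /(_ d dD) qd] pq yp.
    apply/negPn/negP => yq; have yd := yfull d dD.
    (* For [y] in [X] the induced [P5] starts at [c0]; for [y] in [L] it ends at [t], which misses
       [y] since [y] is active in the complement. The other classes are complete or anticomplete to
       [X]. *)
    case/or4P: (five_classes y) => [yX|/setUP[yB|yL]|yC|yT].
    - by case: (@no_P5 _ Gfree c0 d y p q) => //;
        first [exact: D_C | exact: active_anti | rewrite adj_sym].
    - by case/fullnbrsP: yB => _ /(_ q qX); rewrite (negbTE yq).
    - by case: (@no_P5 _ Gfree q p y d t) => //; rewrite adj_sym //;
        first [exact: T_anti_X | exact: yM].
    - by rewrite (negbTE (active_anti yC pX)) in yp.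
    - by rewrite (negbTE (T_anti_X yT pX)) in yp.
  by apply/idP/idP; apply: main; rewrite // adj_sym.
have mix_clique : clique (G := compl_graph G) (mixnbrs (G := G) D).
  apply/cliqueP => t t' /MT tT /MT t'T neq.
  by rewrite compl_adjE //; apply: T_anti_CT tT _; case/setDP: t'T.
apply: (@divide_around (compl_graph G) (prime_compl Gprime) (five_free_compl Gfree)
          D D_connected D_card c0 (cactive c0 c0C));
  rewrite ?mixnbrs_compl ?fullnbrs_compl //.
- by exists c0; [apply: cactive | apply/forall_inP].
- move=> y u v yA uN vN neq; rewrite compl_adjE // negbK => uv.
  have [yF _] := D_act y yA.
  by rewrite !compl_adjE ?fneq // (act_non y u v).
Qed.

End MinimalCandidate.

Lemma divide_or_codivide :
  admits_split_divide G \/ admits_split_divide (compl_graph G).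
Proof.
have [cL|/nonclique_candidate[x xc]] := boolP (clique L).
  by left; apply: divide_of_clique.
right; have [y yc ymin] := arg_minnP (fun z => #|missed z|) xc.
exact: codivide yc ymin.
Qed.

End MaximalConnected.

(** * Reduction to two anticomplete edges *)

Lemma divide_of_2K2 (G : sgraph) (x y u v : G) :
  prime_graph G -> five_free G -> adj x y -> adj u v ->
  ~~ adj x u -> ~~ adj x v -> ~~ adj y u -> ~~ adj y v ->
  admits_split_divide G \/ admits_split_divide (compl_graph G).
Proof.
move=> Gp Gf xy uv xu xv yu yv.
have [X [cX cardX [c cC] cover]] := exists_maximal_connected xy uv xu xv yu yv.
exact: (divide_or_codivide Gp Gf cX cardX cC cover).
Qed.

Theorem theorem3p1 (G : sgraph)
  (hprime : prime_graph G)
  (hP5 : ~ contains_induced (path_graph 5) G)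
  (hcoP5 : ~ contains_induced (compl_graph (path_graph 5)) G)
  (hC5 : ~ contains_induced (cycle_graph 5) G) :
  split_graph G \/ admits_split_divide G \/ admits_split_divide (compl_graph G).
Proof.
have Gf : five_free G by split.
have [/existsP[p]|no2K2] := boolP [exists p : G * G * G * G,
  let: (x, y, u, v) := p in [&& adj x y, adj u v, ~~ adj x u, ~~ adj x v,
    ~~ adj y u & ~~ adj y v]].
  case: p => [[[x y] u] v] /and5P[xy uv xu xv /andP[yu yv]].
  by right; apply: (divide_of_2K2 (x := x) (y := y) (u := u) (v := v)).
have [/existsP[p]|noC4] := boolP [exists p : G * G * G * G,
  let: (x, y, u, v) := p in [&& adj x y, adj y u, adj u v, adj v x,
    x != u, y != v, ~~ adj x u & ~~ adj y v]].
  case: p => [[[x y] u] v] /and5P[xy yu uv vx /and4P[nxu nyv xu yv]].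
  have adjN (p q : G) : adj p q -> ~~ adj (s := compl_graph G) p q.
    by move=> pq; rewrite /= /compl_adj pq andbF.
  have adjP (p q : G) : p != q -> ~~ adj p q -> adj (s := compl_graph G) p q.
    by move=> neq; rewrite compl_adjE.
  have uy : adj u y by rewrite adj_sym.
  (* In the complement the diagonals of the [C4] are two anticomplete edges. *)
  right; have := divide_of_2K2 (prime_compl hprime) (five_free_compl Gf)
    (adjP x u nxu xu) (adjP y v nyv yv) (adjN x y xy) _ (adjN u y uy) (adjN u v uv).
  rewrite compl_graphK => H; case: H; [| by right | by left].
  by apply: adjN; rewrite adj_sym.
left; apply: split_of_forbidden.
- move=> x y u v xy uv xu xv yu yv; case/negP: no2K2; apply/existsP.
  by exists (x, y, u, v); rewrite xy uv xu xv yu yv.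
- move=> x y u v xy yu uv vx nxu nyv xu yv; case/negP: noC4; apply/existsP.
  by exists (x, y, u, v); rewrite xy yu uv vx nxu nyv xu yv.
- exact: no_C5.
Qed.
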